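(* Let $L$ be the free Lie algebra over $\mathbb{C}$ on generators $a,b,c$, with $\mathfrak{sl}_2(\mathbb{C})$ acting on $L$ by derivations extending the adjoint representation on $L_1=\mathrm{span}\{a,b,c\}$. Then the space of Lie invariants of degree 6 (a subspace of $L_6$) has dimension 1 and basis $$\begin{aligned} I_6 &= 4[[[ca][ba]][cb]] - 2[[[cb][ba]][ca]] - 4[[[[ba]a]c][cb]] - [[[[ba]b]b][cb]] + 4[[[[ba]c]c][ba]] \\ &\quad - 8[[[[ca]a]c][ca]] - 2[[[[ca]b]b][ca]] - 4[[[[ca]b]c][ba]] - [[[[cb]b]b][ba]]. \end{aligned}$$
   Context: $L=\bigoplus_{n\ge1}L_n$ is the grading of the free Lie algebra by degree (each generator has degree 1). $\mathfrak{sl}_2(\mathbb{C})$ has standard basis $x,h,y$ with $[h,x]=2x$, $[h,y]=-2y$, $[x,y]=h$. The space $L_1$ is regarded as the adjoint representation by identifying $a,b,c$ with $x,h,y$ respectively, so that $x.a=0$, $x.b=-2a$, $x.c=b$; $h.a=2a$, $h.b=0$, $h.c=-2c$; $y.a=-b$, $y.b=2c$, $y.c=0$. The action extends to all of $L$ by the derivation rule $D.[t,u]=[D.t,u]+[t,D.u]$ for $D\in\mathfrak{sl}_2(\mathbb{C})$. A Lie invariant of degree $j$ is an element $Z\in L_j$ with $D.Z=0$ for all $D\in\mathfrak{sl}_2(\mathbb{C})$. Commas are omitted in Lie brackets: $[uv]$ means $[u,v]$; e.g. $[[[ba]b][cb]]=[[[b,a],b],[c,b]]$. *)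

(* Defs.v *)
From HB Require Import structures.
From mathcomp Require Import all_boot all_order all_algebra.
From mathcomp Require Import generic_quotient.
From mathcomp Require Import boolp classical_sets reals complex.
From mathcomp Require Import ring.

Set Implicit Arguments.
Unset Strict Implicit.
Unset Printing Implicit Defensive.
Import GRing.Theory.
Local Open Scope quotient_scope.
Local Open Scope ring_scope.

HB.mixin Record Lmodule_isLieAlgebra (K : comNzRingType) V of GRing.Lmodule K V := {
  lie : V -> V -> V;
  lie_linearl : forall w k u v, lie (k *: u + v) w = k *: lie u w + lie v w;
  lie_linearr : forall w k u v, lie w (k *: u + v) = k *: lie w u + lie w v;
  liexx : forall u, lie u u = 0;
  lie_jacobi : forall u v w,
    lie u (lie v w) + lie v (lie w u) + lie w (lie u v) = 0 }.

#[short(type="lieAlgType")]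
HB.structure Definition LieAlgebra (K : comNzRingType) :=
  {V of Lmodule_isLieAlgebra K V & GRing.Lmodule K V}.

Notation "[ 'lie' u , v ]" := (lie u v)
  (at level 0, format "[ 'lie'  u ,  v ]") : ring_scope.

Section LieTheory.
Variables (K : comNzRingType) (L : lieAlgType K).
Implicit Types u v w : L.

Lemma lieDl u v w : [lie u + v, w] = [lie u, w] + [lie v, w].
Proof. by have := lie_linearl w 1 u v; rewrite !scale1r. Qed.
Lemma lieDr u v w : [lie u, v + w] = [lie u, v] + [lie u, w].
Proof. by have := lie_linearr u 1 v w; rewrite !scale1r. Qed.
Lemma lie0l u : [lie 0, u] = 0.
Proof. by apply: (addIr [lie 0, u]); rewrite -lieDl !add0r. Qed.
Lemma lie0r u : [lie u, 0] = 0.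
Proof. by apply: (addIr [lie u, 0]); rewrite -lieDr !add0r. Qed.
Lemma lieZl k u v : [lie k *: u, v] = k *: [lie u, v].
Proof. by have := lie_linearl v k u 0; rewrite lie0l !addr0. Qed.
Lemma lieZr k u v : [lie u, k *: v] = k *: [lie u, v].
Proof. by have := lie_linearr u k v 0; rewrite lie0r !addr0. Qed.
Lemma lieC u v : [lie u, v] = - [lie v, u].
Proof.
apply/eqP; rewrite -addr_eq0; apply/eqP.
by have := liexx (u + v); rewrite lieDl !lieDr !liexx add0r addr0.
Qed.
Lemma lieNl u v : [lie - u, v] = - [lie u, v].
Proof. by rewrite -scaleN1r lieZl scaleN1r. Qed.
Lemma lieNr u v : [lie u, - v] = - [lie u, v].
Proof. by rewrite -scaleN1r lieZr scaleN1r. Qed.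

End LieTheory.

Definition lie_morphism (K : comNzRingType) (L M : lieAlgType K) (f : L -> M) :=
  (forall k u v, f (k *: u + v) = k *: f u + f v) /\
  (forall u v, f [lie u, v] = [lie f u, f v]).

Definition derivation (K : comNzRingType) (L : lieAlgType K) (d : L -> L) :=
  (forall k u v, d (k *: u + v) = k *: d u + d v) /\
  (forall u v, d [lie u, v] = [lie d u, v] + [lie u, d v]).

(* The free Lie algebra is built as the syntactic Lie algebra on X: terms in
   the generators modulo the congruence generated by the axioms of Lie algebras. *)
Inductive lie_term (K X : Type) :=
  | TGen of X
  | TZero
  | TOpp of lie_term K X
  | TAdd of lie_term K X & lie_term K X
  | TScale of K & lie_term K X
  | TLie of lie_term K X & lie_term K X.
Arguments TGen {K X}.
Arguments TZero {K X}.

Inductive lie_eqv (K : comNzRingType) (X : Type) :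
    lie_term K X -> lie_term K X -> Prop :=
  | LErefl s : lie_eqv s s
  | LEsym s t : lie_eqv s t -> lie_eqv t s
  | LEtrans s t r : lie_eqv s t -> lie_eqv t r -> lie_eqv s r
  | LEopp s s' : lie_eqv s s' -> lie_eqv (TOpp s) (TOpp s')
  | LEadd s s' t t' : lie_eqv s s' -> lie_eqv t t' ->
      lie_eqv (TAdd s t) (TAdd s' t')
  | LEscale k s s' : lie_eqv s s' -> lie_eqv (TScale k s) (TScale k s')
  | LElie s s' t t' : lie_eqv s s' -> lie_eqv t t' ->
      lie_eqv (TLie s t) (TLie s' t')
  | LEaddA s t r : lie_eqv (TAdd s (TAdd t r)) (TAdd (TAdd s t) r)
  | LEaddC s t : lie_eqv (TAdd s t) (TAdd t s)
  | LEadd0 s : lie_eqv (TAdd TZero s) s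
  | LEaddN s : lie_eqv (TAdd (TOpp s) s) TZero
  | LEscaleA k l s : lie_eqv (TScale k (TScale l s)) (TScale (k * l) s)
  | LEscale1 s : lie_eqv (TScale 1 s) s
  | LEscaleDr k s t :
      lie_eqv (TScale k (TAdd s t)) (TAdd (TScale k s) (TScale k t))
  | LEscaleDl k l s :
      lie_eqv (TScale (k + l) s) (TAdd (TScale k s) (TScale l s))
  | LElinl r k s t : lie_eqv (TLie (TAdd (TScale k s) t) r)
                             (TAdd (TScale k (TLie s r)) (TLie t r))
  | LElinr r k s t : lie_eqv (TLie r (TAdd (TScale k s) t))
                             (TAdd (TScale k (TLie r s)) (TLie r t))
  | LEalt s : lie_eqv (TLie s s) TZero
  | LEjacobi s t r :
      lie_eqv (TAdd (TAdd (TLie s (TLie t r)) (TLie t (TLie r s)))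
                    (TLie r (TLie s t))) TZero.

HB.instance Definition _ (K X : Type) := gen_eqMixin (lie_term K X).
HB.instance Definition _ (K X : Type) := gen_choiceMixin (lie_term K X).

Section FreeLie.
Variables (K : comNzRingType) (X : Type).
Notation term := (lie_term K X).
Implicit Types s t r : term.

Definition lie_eqvb s t : bool := `[< lie_eqv s t >].

Lemma lie_eqvb_equiv : equiv_class_of lie_eqvb.
Proof.
split=> [s|s t|t s r]; first by apply/asboolP; exact: LErefl.
- by apply/asboolP/asboolP; exact: LEsym.
- by move=> /asboolP st /asboolP tr; apply/asboolP; exact: LEtrans st tr.
Qed.

Canonical lie_eqv_equiv := EquivRelPack lie_eqvb_equiv.

Definition freeLie := {eq_quot lie_eqvb}.
HB.instance Definition _ := Choice.on freeLie.
HB.instance Definition _ := EqQuotient.on freeLie.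
Notation L := freeLie.

Lemma fl_eqP s t : \pi_L s = \pi_L t <-> lie_eqv s t.
Proof.
split=> [/eqP|st]; first by rewrite eqmodE => /asboolP.
by apply/eqP; rewrite eqmodE; apply/asboolP.
Qed.

Lemma fl_repr (u : L) : exists t, u = \pi_L t.
Proof. by exists (repr u); rewrite reprK. Qed.

Lemma repr_eqv t : lie_eqv (repr (\pi_L t)) t.
Proof. by apply/fl_eqP; rewrite reprK. Qed.

Definition fl_gen (x : X) : L := \pi_L (TGen x).
Definition fl_zero : L := \pi_L TZero.
Definition fl_opp (u : L) : L := \pi_L (TOpp (repr u)).
Definition fl_add (u v : L) : L := \pi_L (TAdd (repr u) (repr v)).
Definition fl_scale (k : K) (u : L) : L := \pi_L (TScale k (repr u)).
Definition fl_lie (u v : L) : L := \pi_L (TLie (repr u) (repr v)).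

Lemma fl_oppE t : fl_opp (\pi_L t) = \pi_L (TOpp t).
Proof. by apply/fl_eqP/LEopp/repr_eqv. Qed.
Lemma fl_addE s t : fl_add (\pi_L s) (\pi_L t) = \pi_L (TAdd s t).
Proof. by apply/fl_eqP/LEadd; exact: repr_eqv. Qed.
Lemma fl_scaleE k t : fl_scale k (\pi_L t) = \pi_L (TScale k t).
Proof. by apply/fl_eqP/LEscale/repr_eqv. Qed.
Lemma fl_lieE s t : fl_lie (\pi_L s) (\pi_L t) = \pi_L (TLie s t).
Proof. by apply/fl_eqP/LElie; exact: repr_eqv. Qed.

Let flE := (fl_oppE, fl_addE, fl_scaleE, fl_lieE).

Fact fl_addA : associative fl_add.
Proof.
move=> u v w; have [[r ->] [s ->] [t ->]] := And3 (fl_repr u) (fl_repr v) (fl_repr w).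
by rewrite !flE; apply/fl_eqP/LEaddA.
Qed.
Fact fl_addC : commutative fl_add.
Proof.
move=> u v; have [s ->] := fl_repr u; have [t ->] := fl_repr v.
by rewrite !flE; apply/fl_eqP/LEaddC.
Qed.
Fact fl_add0 : left_id fl_zero fl_add.
Proof.
by move=> u; have [s ->] := fl_repr u; rewrite !flE; apply/fl_eqP/LEadd0.
Qed.
Fact fl_addN : left_inverse fl_zero fl_opp fl_add.
Proof.
by move=> u; have [s ->] := fl_repr u; rewrite !flE; apply/fl_eqP/LEaddN.
Qed.
HB.instance Definition _ :=
  GRing.isZmodule.Build freeLie fl_addA fl_addC fl_add0 fl_addN.

Fact fl_scaleA k l u : fl_scale k (fl_scale l u) = fl_scale (k * l) u.
Proof. by have [s ->] := fl_repr u; rewrite !flE; apply/fl_eqP/LEscaleA. Qed.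
Fact fl_scale1 : left_id 1 fl_scale.
Proof.
by move=> u; have [s ->] := fl_repr u; rewrite !flE; apply/fl_eqP/LEscale1.
Qed.
Fact fl_scaleDr : right_distributive fl_scale +%R.
Proof.
move=> k u v; have [s ->] := fl_repr u; have [t ->] := fl_repr v.
by rewrite /GRing.add /= !flE; apply/fl_eqP/LEscaleDr.
Qed.
Fact fl_scaleDl u : {morph fl_scale^~ u : k l / k + l}.
Proof.
move=> k l; have [s ->] := fl_repr u.
by rewrite [RHS]/GRing.add /= !flE; apply/fl_eqP/LEscaleDl.
Qed.
HB.instance Definition _ := GRing.Zmodule_isLmodule.Build K freeLie
  fl_scaleA fl_scale1 fl_scaleDr fl_scaleDl.

Lemma piZero : \pi_L TZero = 0. Proof. by []. Qed.
Lemma piOpp t : \pi_L (TOpp t) = - \pi_L t.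
Proof. by rewrite -fl_oppE. Qed.
Lemma piAdd s t : \pi_L (TAdd s t) = \pi_L s + \pi_L t.
Proof. by rewrite -fl_addE. Qed.
Lemma piScale k t : \pi_L (TScale k t) = k *: \pi_L t.
Proof. by rewrite -fl_scaleE. Qed.

Fact fl_linearl w k (u v : L) :
  fl_lie (k *: u + v) w = k *: fl_lie u w + fl_lie v w.
Proof.
have [[r ->] [s ->] [t ->]] := And3 (fl_repr u) (fl_repr v) (fl_repr w).
by rewrite -piScale -piAdd !fl_lieE -piScale -piAdd; apply/fl_eqP/LElinl.
Qed.
Fact fl_linearr w k (u v : L) :
  fl_lie w (k *: u + v) = k *: fl_lie w u + fl_lie w v.
Proof.
have [[r ->] [s ->] [t ->]] := And3 (fl_repr u) (fl_repr v) (fl_repr w).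
by rewrite -piScale -piAdd !fl_lieE -piScale -piAdd; apply/fl_eqP/LElinr.
Qed.
Fact fl_liexx u : fl_lie u u = 0.
Proof. by have [s ->] := fl_repr u; rewrite fl_lieE; apply/fl_eqP/LEalt. Qed.
Fact fl_jacobi (u v w : L) :
  fl_lie u (fl_lie v w) + fl_lie v (fl_lie w u) + fl_lie w (fl_lie u v) = 0.
Proof.
have [[r ->] [s ->] [t ->]] := And3 (fl_repr u) (fl_repr v) (fl_repr w).
by rewrite !fl_lieE -!piAdd; apply/fl_eqP/LEjacobi.
Qed.
HB.instance Definition _ := Lmodule_isLieAlgebra.Build K freeLie
  fl_linearl fl_linearr fl_liexx fl_jacobi.

Lemma piLie s t : \pi_L (TLie s t) = [lie \pi_L s, \pi_L t].
Proof. by rewrite -fl_lieE. Qed.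

Definition piE := (piZero, piOpp, piAdd, piScale, piLie).

Lemma fl_ind (P : L -> Prop) :
  (forall x, P (fl_gen x)) ->
  (forall k u v, P u -> P v -> P (k *: u + v)) ->
  (forall u v, P u -> P v -> P [lie u, v]) -> P 0 -> forall u, P u.
Proof.
move=> Pg Pl Pb P0 u; have [t ->] := fl_repr u.
elim: t => [x||t IH|s IHs t IHt|k t IH|s IHs t IHt]; rewrite ?piE //.
- exact: Pg.
- by have := Pl (-1) _ _ IH P0; rewrite scaleN1r addr0.
- by have := Pl 1 _ _ IHs IHt; rewrite scale1r.
- by have := Pl k _ _ IH P0; rewrite addr0.
- exact: Pb.
Qed.

Section Lift.
Variables (M : lieAlgType K) (f : X -> M).

Fixpoint term_lift t : M :=
  match t with
  | TGen x => f x
  | TZero => 0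
  | TOpp s => - term_lift s
  | TAdd s r => term_lift s + term_lift r
  | TScale k s => k *: term_lift s
  | TLie s r => [lie term_lift s, term_lift r]
  end.

Definition fl_lift (u : L) : M := term_lift (repr u).

Lemma term_lift_eqv s t : lie_eqv s t -> term_lift s = term_lift t.
Proof.
elim=> {s t} //=.
- by move=> s t r _ -> _ ->.
- by move=> s s' _ ->.
- by move=> s s' r r' _ -> _ ->.
- by move=> k s s' _ ->.
- by move=> s s' r r' _ -> _ ->.
- by move=> *; rewrite addrA.
- by move=> *; rewrite addrC.
- by move=> *; rewrite add0r.
- by move=> *; rewrite addNr.
- by move=> *; rewrite scalerA.
- by move=> *; rewrite scale1r.
- by move=> *; rewrite scalerDr.
- by move=> *; rewrite scalerDl.
- by move=> *; rewrite lie_linearl.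
- by move=> *; rewrite lie_linearr.
- by move=> *; rewrite liexx.
- by move=> *; rewrite lie_jacobi.
Qed.

Lemma fl_lift_pi t : fl_lift (\pi_L t) = term_lift t.
Proof. exact: term_lift_eqv (repr_eqv t). Qed.

Lemma fl_lift_gen x : fl_lift (fl_gen x) = f x.
Proof. exact: fl_lift_pi. Qed.

Lemma fl_lift_morphism : lie_morphism fl_lift.
Proof.
split=> [k u v|u v]; have [s ->] := fl_repr u; have [t ->] := fl_repr v.
  by rewrite -piScale -piAdd !fl_lift_pi.
by rewrite -piLie !fl_lift_pi.
Qed.

Lemma fl_lift_unique (g : L -> M) :
  lie_morphism g -> (forall x, g (fl_gen x) = f x) -> g =1 fl_lift.
Proof.
move=> [gl gb] gf; have [ll lb] := fl_lift_morphism; elim/fl_ind.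
- by move=> x; rewrite gf fl_lift_gen.
- by move=> k u v IHu IHv; rewrite gl ll IHu IHv.
- by move=> u v IHu IHv; rewrite gb lb IHu IHv.
- have z (h : L -> M) : (forall k u v, h (k *: u + v) = k *: h u + h v) -> h 0 = 0.
    move=> hl; have := hl 1 0 0; rewrite !scale1r addr0 => h0.
    by apply: (addIr (h 0)); rewrite add0r -h0.
  by rewrite (z _ gl) (z _ ll).
Qed.

End Lift.

Section Derivation.
Variable f : X -> L.

Fixpoint term_der t : L :=
  match t with
  | TGen x => f x
  | TZero => 0
  | TOpp s => - term_der s
  | TAdd s r => term_der s + term_der r
  | TScale k s => k *: term_der s
  | TLie s r => [lie term_der s, \pi_L r] + [lie \pi_L s, term_der r]
  end.

Definition fl_der (u : L) : L := term_der (repr u).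

Lemma term_der_eqv s t : lie_eqv s t -> term_der s = term_der t.
Proof.
elim=> {s t} //=.
- by move=> s t r _ -> _ ->.
- by move=> s s' _ ->.
- by move=> s s' r r' _ -> _ ->.
- by move=> k s s' _ ->.
- by move=> s s' r r' /fl_eqP -> -> /fl_eqP -> ->.
- by move=> *; rewrite addrA.
- by move=> *; rewrite addrC.
- by move=> *; rewrite add0r.
- by move=> *; rewrite addNr.
- by move=> *; rewrite scalerA.
- by move=> *; rewrite scale1r.
- by move=> *; rewrite scalerDr.
- by move=> *; rewrite scalerDl.
- by move=> r k s r'; rewrite !piE !lie_linearl !scalerDr addrACA.
- by move=> r k s r'; rewrite !piE !lie_linearr !scalerDr addrACA.
- by move=> s; rewrite [X in X + _]lieC addNr.
move=> s r q; rewrite !piE !lieDr !addrA.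
move: (term_der s) (term_der r) (term_der q) (\pi_L s) (\pi_L r) (\pi_L q).
move=> ds dr dq u v w.
rewrite [LHS](ACl ((1 * 6 * 8) * (2 * 4 * 9) * (3 * 5 * 7))) /=.
by rewrite !lie_jacobi !addr0.
Qed.

Lemma fl_der_pi t : fl_der (\pi_L t) = term_der t.
Proof. exact: term_der_eqv (repr_eqv t). Qed.

Lemma fl_der_gen x : fl_der (fl_gen x) = f x.
Proof. exact: fl_der_pi. Qed.

Lemma fl_der_derivation : derivation fl_der.
Proof.
split=> [k u v|u v]; have [s ->] := fl_repr u; have [t ->] := fl_repr v.
  by rewrite -piScale -piAdd !fl_der_pi.
by rewrite -piLie !fl_der_pi.
Qed.

End Derivation.

(* The grading: L_n is the n-th member of the least family of linear subspaces
   with the generators in degree 1 that is compatible with brackets. *)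
Inductive fl_homog : nat -> L -> Prop :=
  | Homog_gen x : fl_homog 1 (fl_gen x)
  | Homog_lie m n u v :
      fl_homog m u -> fl_homog n v -> fl_homog (m + n) [lie u, v]
  | Homog0 n : fl_homog n 0
  | Homog_lin n k u v : fl_homog n u -> fl_homog n v -> fl_homog n (k *: u + v).

End FreeLie.

Arguments fl_gen {K X}.

Section Sl2.
Variable K : comNzRingType.

Definition traceless : {pred 'M[K]_2} := fun A => \tr A == 0.

Fact traceless_submod : submod_closed traceless.
Proof.
split=> [|k A B]; rewrite !unfold_in ?mxtrace0 // => /eqP A0 /eqP B0.
by rewrite mxtraceD mxtraceZ A0 B0 mulr0 addr0.
Qed.
HB.instance Definition _ :=
  GRing.isSubmodClosed.Build K 'M[K]_2 traceless traceless_submod.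

Record sl2 := Sl2 { sl2_mx :> 'M[K]_2; sl2_traceless : sl2_mx \in traceless }.
HB.instance Definition _ := [isSub for sl2_mx].
HB.instance Definition _ := [Choice of sl2 by <:].
HB.instance Definition _ := [SubChoice_isSubLmodule of sl2 by <:].

Definition mx_comm n (A B : 'M[K]_n) := A *m B - B *m A.

Fact mx_comm_traceless n (A B : 'M[K]_n) : \tr (mx_comm A B) == 0.
Proof. by rewrite mxtraceD raddfN /= mxtrace_mulC subrr. Qed.

Definition sl2_lie (A B : sl2) : sl2 := Sl2 (mx_comm_traceless A B).

Fact sl2_linearl (C : sl2) k (A B : sl2) :
  sl2_lie (k *: A + B) C = k *: sl2_lie A C + sl2_lie B C.
Proof.
apply: val_inj; rewrite /= /mx_comm mulmxDl mulmxDr -scalemxAl -scalemxAr.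
by rewrite scalerBr opprD addrACA.
Qed.
Fact sl2_linearr (C : sl2) k (A B : sl2) :
  sl2_lie C (k *: A + B) = k *: sl2_lie C A + sl2_lie C B.
Proof.
apply: val_inj; rewrite /= /mx_comm mulmxDl mulmxDr -scalemxAl -scalemxAr.
by rewrite scalerBr opprD addrACA.
Qed.
Fact sl2_liexx A : sl2_lie A A = 0.
Proof. by apply: val_inj; rewrite /= /mx_comm subrr. Qed.
Fact sl2_jacobi (A B C : sl2) :
  sl2_lie A (sl2_lie B C) + sl2_lie B (sl2_lie C A) + sl2_lie C (sl2_lie A B)
  = 0.
Proof.
apply: val_inj; rewrite /= /mx_comm !mulmxBl !mulmxBr !mulmxA.
move: (val A *m val B *m val C) (val A *m val C *m val B) => ABC ACB.
move: (val B *m val A *m val C) (val B *m val C *m val A) => BAC BCA.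
move: (val C *m val A *m val B) (val C *m val B *m val A) => CAB CBA.
by apply/matrixP => i j; rewrite !mxE; ring.
Qed.
HB.instance Definition _ := Lmodule_isLieAlgebra.Build K sl2
  sl2_linearl sl2_linearr sl2_liexx sl2_jacobi.

Definition sl2_x_mx : 'M[K]_2 := delta_mx 0 1.
Definition sl2_h_mx : 'M[K]_2 := delta_mx 0 0 - delta_mx 1 1.
Definition sl2_y_mx : 'M[K]_2 := delta_mx 1 0.

Fact sl2_x_traceless : sl2_x_mx \in traceless.
Proof. by rewrite unfold_in /mxtrace !big_ord_recl big_ord0 !mxE !addr0. Qed.
Fact sl2_h_traceless : sl2_h_mx \in traceless.
Proof.
by rewrite unfold_in /mxtrace !big_ord_recl big_ord0 !mxE /= subr0 sub0r addr0 subrr.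
Qed.
Fact sl2_y_traceless : sl2_y_mx \in traceless.
Proof. by rewrite unfold_in /mxtrace !big_ord_recl big_ord0 !mxE !addr0. Qed.

Definition sl2_x : sl2 := Sl2 sl2_x_traceless.
Definition sl2_h : sl2 := Sl2 sl2_h_traceless.
Definition sl2_y : sl2 := Sl2 sl2_y_traceless.

Lemma sl2_11 (A : sl2) : A 1 1 = - A 0 0.
Proof.
apply/eqP; rewrite -addr_eq0 addrC; have := sl2_traceless A.
rewrite unfold_in /mxtrace !big_ord_recl big_ord0 addr0.
by have -> : lift 0 0 = 1 :> 'I_2 by apply: val_inj.
Qed.

Lemma sl2_eq (A B : sl2) :
  A 0 1 = B 0 1 -> A 0 0 = B 0 0 -> A 1 0 = B 1 0 -> A = B.
Proof.
move=> e01 e00 e10; apply: val_inj; apply/matrixP => i j /=.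
have ord2 (k : 'I_2) : k = 0 \/ k = 1.
  by case: k => [[|[|//]] lt_k]; [left | right]; apply: val_inj.
by case: (ord2 i) => ->; case: (ord2 j) => -> //; rewrite !sl2_11 e00.
Qed.

Lemma sl2_lieE (A B : sl2) :
  [/\ [lie A, B] 0 0 = A 0 1 * B 1 0 - B 0 1 * A 1 0,
      [lie A, B] 0 1 = 2%:R * (A 0 0 * B 0 1 - A 0 1 * B 0 0) &
      [lie A, B] 1 0 = 2%:R * (A 1 0 * B 0 0 - A 0 0 * B 1 0)].
Proof.
have e : lift 0 0 = 1 :> 'I_2 by apply: val_inj.
by split; rewrite /= !mxE !big_ord_recl !big_ord0 !e ?sl2_11; ring.
Qed.

Lemma sl2_coord (A : sl2) :
  A = A 0 1 *: sl2_x + A 0 0 *: sl2_h + A 1 0 *: sl2_y.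
Proof. by apply: sl2_eq; rewrite /= !mxE /=; ring. Qed.

Lemma sl2_lie_hx : [lie sl2_h, sl2_x] = 2%:R *: sl2_x.
Proof.
have [e00 e01 e10] := sl2_lieE sl2_h sl2_x.
by apply: sl2_eq; rewrite (e00, e01, e10) /= !mxE /=; ring.
Qed.
Lemma sl2_lie_hy : [lie sl2_h, sl2_y] = - (2%:R *: sl2_y).
Proof.
have [e00 e01 e10] := sl2_lieE sl2_h sl2_y.
by apply: sl2_eq; rewrite (e00, e01, e10) /= !mxE /=; ring.
Qed.
Lemma sl2_lie_xy : [lie sl2_x, sl2_y] = sl2_h.
Proof.
have [e00 e01 e10] := sl2_lieE sl2_x sl2_y.
by apply: sl2_eq; rewrite (e00, e01, e10) /= !mxE /=; ring.
Qed.

End Sl2.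

Arguments sl2_x {K}.
Arguments sl2_h {K}.
Arguments sl2_y {K}.

Inductive letter := La | Lb | Lc.

Section Invariants.
Variable K : comNzRingType.
Notation L := (freeLie K letter).
Notation a := (fl_gen La : L).
Notation b := (fl_gen Lb : L).
Notation c := (fl_gen Lc : L).

Definition letter_sl2 (i : letter) : sl2 K :=
  match i with La => sl2_x | Lb => sl2_h | Lc => sl2_y end.

(* A traceless matrix A equals A 0 1 *: x + A 0 0 *: h + A 1 0 *: y, so this is
   the linear identification of sl2 with L_1 sending x, h, y to a, b, c. *)
Definition sl2_to_L1 (A : sl2 K) : L := A 0 1 *: a + A 0 0 *: b + A 1 0 *: c.

Definition sl2_act (D : sl2 K) : L -> L :=
  fl_der (fun i => sl2_to_L1 [lie D, letter_sl2 i]).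

Lemma sl2_to_L1_lin k (A B : sl2 K) :
  sl2_to_L1 (k *: A + B) = k *: sl2_to_L1 A + sl2_to_L1 B.
Proof.
rewrite /sl2_to_L1 /= !mxE !scalerDl !scalerDr !scalerA.
by rewrite [LHS](AC ((2*2)*2) ((1*3*5)*(2*4*6))).
Qed.

Lemma sl2_act_derivation D : derivation (sl2_act D).
Proof. exact: fl_der_derivation. Qed.

Lemma sl2_act_gen D i : sl2_act D (fl_gen i) = sl2_to_L1 [lie D, letter_sl2 i].
Proof. exact: fl_der_gen. Qed.

Lemma sl2_act0 D : sl2_act D 0 = 0.
Proof.
have := (sl2_act_derivation D).1 (-1) 0 0.
by rewrite scaler0 addr0 scaleN1r addNr.
Qed.

Lemma sl2_actZ D k u : sl2_act D (k *: u) = k *: sl2_act D u.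
Proof. by have := (sl2_act_derivation D).1 k u 0; rewrite sl2_act0 !addr0. Qed.

Lemma sl2_actD D u v : sl2_act D (u + v) = sl2_act D u + sl2_act D v.
Proof. by have := (sl2_act_derivation D).1 1 u v; rewrite !scale1r. Qed.

Lemma sl2_act_L1 D A : sl2_act D (sl2_to_L1 A) = sl2_to_L1 [lie D, A].
Proof.
rewrite {1}/sl2_to_L1 !sl2_actD !sl2_actZ !sl2_act_gen /= [in RHS](sl2_coord A).
rewrite -[in RHS]addrA lie_linearr sl2_to_L1_lin lie_linearr sl2_to_L1_lin lieZr.
have e k (B : sl2 K) : sl2_to_L1 (k *: B) = k *: sl2_to_L1 B.
  by rewrite /sl2_to_L1 /= !mxE !scalerDr !scalerA.
by rewrite e addrA.
Qed.

Lemma sl2_act_linearl k D E u :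
  sl2_act (k *: D + E) u = k *: sl2_act D u + sl2_act E u.
Proof.
elim/fl_ind: u => [i|l u v IHu IHv|u v IHu IHv|].
- by rewrite !sl2_act_gen lie_linearl sl2_to_L1_lin.
- rewrite !(sl2_act_derivation _).1 IHu IHv !scalerDr !scalerA (mulrC l).
  by rewrite addrACA.
- rewrite !(sl2_act_derivation _).2 IHu IHv lie_linearl lie_linearr.
  by rewrite scalerDr addrACA.
- by rewrite !sl2_act0 scaler0 addr0.
Qed.

Lemma sl2_act_lie D E u :
  sl2_act [lie D, E] u = sl2_act D (sl2_act E u) - sl2_act E (sl2_act D u).
Proof.
elim/fl_ind: u => [i|l u v IHu IHv|u v IHu IHv|].
- rewrite !sl2_act_gen !sl2_act_L1; set A := letter_sl2 i.
  rewrite [RHS]addrC -scaleN1r -sl2_to_L1_lin scaleN1r; congr sl2_to_L1.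
  have := lie_jacobi D E A; rewrite (lieC A D) (lieC A [lie D, E]) lieNr.
  by move/eqP; rewrite subr_eq0 => /eqP <-; rewrite addrC.
- rewrite !(sl2_act_derivation _).1 IHu IHv scalerBr opprD.
  by rewrite addrACA.
- rewrite !(sl2_act_derivation _).2 !sl2_actD !(sl2_act_derivation _).2.
  rewrite IHu IHv !(lieDl, lieDr, lieNl, lieNr) !opprD.
  set p := [lie sl2_act D u, sl2_act E v]; set q := [lie sl2_act E u, _].
  rewrite !addrA [RHS](ACl (1*5*4*8*(2*7)*(3*6))) /= -/q.
  by rewrite !addrN !addr0.
- by rewrite !sl2_act0 subr0.
Qed.

Lemma sl2_act_table :
  [/\ [/\ sl2_act sl2_x a = 0, sl2_act sl2_x b = - (2%:R *: a)
         & sl2_act sl2_x c = b],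
      [/\ sl2_act sl2_h a = 2%:R *: a, sl2_act sl2_h b = 0
         & sl2_act sl2_h c = - (2%:R *: c)] &
      [/\ sl2_act sl2_y a = - b, sl2_act sl2_y b = 2%:R *: c
         & sl2_act sl2_y c = 0]].
Proof.
have ex : sl2_to_L1 sl2_x = a.
  by rewrite /sl2_to_L1 /= !mxE /= !scale0r scale1r !addr0.
have eh : sl2_to_L1 sl2_h = b.
  by rewrite /sl2_to_L1 /= !mxE /= !subr0 !scale0r scale1r addr0 add0r.
have ey : sl2_to_L1 sl2_y = c.
  by rewrite /sl2_to_L1 /= !mxE /= !scale0r scale1r !add0r.
rewrite -ex -eh -ey !sl2_act_L1 !liexx (lieC sl2_x sl2_h) (lieC sl2_y sl2_x).
rewrite (lieC sl2_y sl2_h) sl2_lie_hx sl2_lie_hy sl2_lie_xy.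
have z : sl2_to_L1 0 = 0 by rewrite /sl2_to_L1 /= !mxE !scale0r !addr0.
have e k B : sl2_to_L1 (k *: B) = k *: sl2_to_L1 B.
  by rewrite -[k *: B]addr0 sl2_to_L1_lin z addr0.
have n B : sl2_to_L1 (- B) = - sl2_to_L1 B by rewrite -scaleN1r e scaleN1r.
by rewrite !n !e z opprK.
Qed.

Definition lie_invariant (j : nat) : set L :=
  [set Z | fl_homog j Z /\ forall D : sl2 K, sl2_act D Z = 0].

Definition I6 : L :=
    4%:R *: [lie [lie [lie c, a], [lie b, a]], [lie c, b]]
  - 2%:R *: [lie [lie [lie c, b], [lie b, a]], [lie c, a]]
  - 4%:R *: [lie [lie [lie [lie b, a], a], c], [lie c, b]]
  - [lie [lie [lie [lie b, a], b], b], [lie c, b]]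
  + 4%:R *: [lie [lie [lie [lie b, a], c], c], [lie b, a]]
  - 8%:R *: [lie [lie [lie [lie c, a], a], c], [lie c, a]]
  - 2%:R *: [lie [lie [lie [lie c, a], b], b], [lie c, a]]
  - 4%:R *: [lie [lie [lie [lie c, a], b], c], [lie b, a]]
  - [lie [lie [lie [lie c, b], b], b], [lie b, a]].

End Invariants.

Arguments lie_invariant : clear implicits.
Arguments I6 : clear implicits.

Section Basis.
Variables (K : comNzRingType) (V : lmodType K).

Definition is_basis (n : nat) (S : set V) (e : 'I_n -> V) : Prop :=
  (forall k : 'I_n -> K, \sum_(i < n) k i *: e i = 0 -> forall i, k i = 0) /\
  S = [set v | exists k : 'I_n -> K, v = \sum_(i < n) k i *: e i]%classic.

Definition has_dim (S : set V) (n : nat) : Prop :=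
  exists e : 'I_n -> V, is_basis S e.

End Basis.

(* Main.v *)
Require Import Defs.
From HB Require Import structures.
From Stdlib Require Import ZArith.
From mathcomp Require Import all_boot all_order all_algebra.
From mathcomp Require Import boolp classical_sets functions reals complex.
From mathcomp Require Import ring ssrZ.
Set Implicit Arguments.
Unset Strict Implicit.
Unset Printing Implicit Defensive.
Import GRing.Theory Num.Theory.
Local Open Scope ring_scope.

(** Sending each generator to the corresponding variable defines a morphism
    [expand] from the free Lie algebra to noncommutative power series with the
    commutator bracket.  The Dynkin-Specht-Wever identity says that, for u
    homogeneous of degree n, replacing each word of [expand u] by its
    right-normed bracket gives n u ([dynkin_specht_wever]).  In characteristic 0
    this has two consequences: [expand] is injective in each positive degree
    ([expand_inj_homog]), so that equalities in the free Lie algebra can be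
    tested on finitely many coefficients, and the right-normed brackets of words of
    length n span L_n, with coefficients that can be read off [expand u].

    A derivation of the free Lie algebra becomes a substitution of letters on
    series ([expand_der]), so the action of sl2 is computable too.  That I6 is
    an invariant and is not zero is then a finite computation.

    For uniqueness, recall that yx acts on the weight 0 vectors of the
    irreducible representation of highest weight 2m as the scalar m(m+1).  The
    vectors of degree 6 have weights between -12 and 12, and weight 12 occurs
    only in the word aaaaaa, which is in no Lie element.  So the product P of
    the operators yx - m(m+1) for m from 1 to 5 maps the weight 0 part of L_6 to
    the invariants.  On an invariant Z it is multiplication by the nonzero number
    q = - 5! 6!.  Writing 6 Z as a combination of right-normed brackets, where h
    shows that only words of weight 0 occur, and applying P gives

      6 q Z = sum over words w of weight 0 of (expand Z)(w) P(right_normed w).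

    The 141 values P(right_normed w) are computed exactly and each is a multiple
    of I6 ([filter_right_normed]); hence so is Z ([lie_invariant6]). *)

(** * Noncommutative power series *)

Definition ncseries (K : comNzRingType) (X : Type) := seq X -> K.

Section Convolution.
Variables (K : comNzRingType) (X : Type).
Notation A := (ncseries K X).
Implicit Types (f g h : A) (w : seq X).

HB.instance Definition _ := GRing.Lmodule.copy A (seq X -> K^o).

Definition ncshift (x : X) f : A := fun w => f (x :: w).

(** The convolution product, by recursion on the word: the coefficient of xv in
    fg is the constant term of f times the coefficient of xv in g, plus the
    coefficient of v in (x^-1 f) g, where x^-1 f is [ncshift x f].  This form
    makes associativity and the Leibniz rule plain inductions, without sums over
    the factorizations of a word. *)
Fixpoint ncmul f g w {struct w} : K :=
  if w is x :: v then f [::] * g w + ncmul (ncshift x f) g v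
  else f [::] * g [::].

Lemma ncmul_linearl k f f' g w :
  ncmul (k *: f + f') g w = k * ncmul f g w + ncmul f' g w.
Proof.
elim: w f f' => [|x w IHw] f f' /=.
  by rewrite mulrDl mulrA.
rewrite -[ncshift x _]/(k *: ncshift x f + ncshift x f') IHw.
by rewrite /= mulrDl mulrDr mulrA addrACA.
Qed.

Lemma ncmul_linearr k f g g' w :
  ncmul f (k *: g + g') w = k * ncmul f g w + ncmul f g' w.
Proof.
elim: w f => [|x w IHw] f /=.
  by rewrite mulrDr mulrCA.
by rewrite IHw mulrDr mulrDr addrACA mulrCA.
Qed.

Lemma ncmul0l g w : ncmul 0 g w = 0.
Proof.
have := ncmul_linearl (-1) 0 0 g w.
by rewrite scaler0 addr0 mulN1r addNr.
Qed.

Lemma ncmulDl f f' g w : ncmul (f + f') g w = ncmul f g w + ncmul f' g w.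
Proof. by have := ncmul_linearl 1 f f' g w; rewrite scale1r mul1r. Qed.

Lemma ncmulZl k f g w : ncmul (k *: f) g w = k * ncmul f g w.
Proof. by have := ncmul_linearl k f 0 g w; rewrite ncmul0l !addr0. Qed.

Lemma ncmulBl f f' g w : ncmul (f - f') g w = ncmul f g w - ncmul f' g w.
Proof. by rewrite ncmulDl -scaleN1r ncmulZl mulN1r. Qed.

Lemma ncmulBr f g g' w : ncmul f (g - g') w = ncmul f g w - ncmul f g' w.
Proof. by rewrite addrC -scaleN1r ncmul_linearr mulN1r addrC. Qed.

Lemma ncmul_suml (I : Type) (r : seq I) (F : I -> A) g w :
  ncmul (\sum_(i <- r) F i) g w = \sum_(i <- r) ncmul (F i) g w.
Proof.
elim: r => [|i r IHr]; first by rewrite !big_nil ncmul0l.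
by rewrite !big_cons ncmulDl IHr.
Qed.

Lemma ncmulA f g h w : ncmul f (ncmul g h) w = ncmul (ncmul f g) h w.
Proof.
elim: w f g => [|x w IHw] f g /=; first by rewrite mulrA.
have -> : ncshift x (ncmul f g)
    = f [::] *: ncshift x g + ncmul (ncshift x f) g by [].
by rewrite ncmul_linearl -IHw mulrDr !mulrA addrA.
Qed.

Definition ncbracket f g : A := ncmul f g - ncmul g f.

Fact ncbracket_linearl h k f g :
  ncbracket (k *: f + g) h = k *: ncbracket f h + ncbracket g h.
Proof.
apply/funext => w.
rewrite /ncbracket !fctE ncmul_linearl ncmul_linearr.
by rewrite scalerBr opprD addrACA.
Qed.
Fact ncbracket_linearr h k f g :
  ncbracket h (k *: f + g) = k *: ncbracket h f + ncbracket h g.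
Proof.
apply/funext => w.
rewrite /ncbracket !fctE ncmul_linearl ncmul_linearr.
by rewrite scalerBr opprD addrACA.
Qed.
Fact ncbracketxx f : ncbracket f f = 0.
Proof. by rewrite /ncbracket subrr. Qed.
Fact ncbracket_jacobi f g h :
  ncbracket f (ncbracket g h) + ncbracket g (ncbracket h f)
  + ncbracket h (ncbracket f g) = 0.
Proof.
apply/funext => w.
rewrite -[LHS]/(ncmul f (ncbracket g h) w - ncmul (ncbracket g h) f w
  + (ncmul g (ncbracket h f) w - ncmul (ncbracket h f) g w)
  + (ncmul h (ncbracket f g) w - ncmul (ncbracket f g) h w)).
rewrite /ncbracket !ncmulBl !ncmulBr !ncmulA -[RHS]/(0 : K).
by ring.
Qed.
HB.instance Definition _ := Lmodule_isLieAlgebra.Build K A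
  ncbracket_linearl ncbracket_linearr ncbracketxx ncbracket_jacobi.

Definition nchomog n f := forall w, size w != n -> f w = 0.

Lemma nchomog_shift n x f : nchomog n.+1 f -> nchomog n (ncshift x f).
Proof. by move=> fn w wn; apply: fn. Qed.

Lemma nchomog0_shift x f : nchomog 0 f -> ncshift x f = 0.
Proof. by move=> f0; apply/funext => w; apply: f0. Qed.

Lemma nchomog_mul m n f g :
  nchomog m f -> nchomog n g -> nchomog (m + n) (ncmul f g).
Proof.
move=> fm gn w; elim: w m f fm => [|x w IHw] [|m] f fm /= wn.
- by rewrite [g _]gn ?mulr0.
- by rewrite fm ?mul0r.
- by rewrite gn // mulr0 nchomog0_shift // ncmul0l addr0.
- by rewrite fm // mul0r add0r (IHw m) //; apply: nchomog_shift.
Qed.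

End Convolution.

(** * The Dynkin-Specht-Wever identity *)

Section WordSums.
Variables (X : finType) (V : nmodType).
Implicit Types (F G : seq X -> V).

Fixpoint wordsum n F : V :=
  if n is m.+1 then \sum_x wordsum m (fun w => F (x :: w)) else F [::].

Lemma eq_wordsum n F G :
  (forall w, size w = n -> F w = G w) -> wordsum n F = wordsum n G.
Proof.
elim: n F G => [|n IHn] F G FG /=; first exact: FG.
by apply: eq_bigr => x _; apply: IHn => w wn; apply: FG; rewrite /= wn.
Qed.

Lemma wordsum_closed (P : V -> Prop) n F :
  P 0 -> (forall u v, P u -> P v -> P (u + v)) ->
  (forall w, size w = n -> P (F w)) -> P (wordsum n F).
Proof.
move=> P0 PD; elim: n F => [|n IHn] F PF /=; first exact: PF.
by apply: big_ind => // x _; apply: IHn => w wn; apply: PF; rewrite /= wn.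
Qed.

Lemma wordsum0 n F : (forall w, size w = n -> F w = 0) -> wordsum n F = 0.
Proof.
by move=> F0; apply: (wordsum_closed (P := eq^~ 0)) => // u v -> ->; rewrite addr0.
Qed.

Lemma wordsumD n F G : wordsum n (fun w => F w + G w) = wordsum n F + wordsum n G.
Proof.
elim: n F G => [|n IHn] F G //=.
by rewrite -big_split; apply: eq_bigr => x _; apply: IHn.
Qed.

End WordSums.

Lemma wordsum_morph (X : finType) (V V' : nmodType) (d : V -> V') n F :
  d 0 = 0 -> {morph d : u v / u + v} ->
  d (wordsum n F) = wordsum n (fun w : seq X => d (F w)).
Proof.
move=> d0 dD; elim: n F => [|n IHn] F //=.
by rewrite (big_morph d dD d0); apply: eq_bigr => x _; apply: IHn.
Qed.

Section Evaluation.
Variables (K : comNzRingType) (X : finType) (V : lmodType K).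
Implicit Types (f g : ncseries K X) (E : seq X -> V).

(** The image of the degree n part of f under the linear map that sends each
    word w to [E w]. *)
Definition nceval n f E := wordsum n (fun w => f w *: E w).

Lemma ncevalD n f g E : nceval n (f + g) E = nceval n f E + nceval n g E.
Proof.
by rewrite -wordsumD; apply: eq_wordsum => w _; rewrite -scalerDl.
Qed.

Lemma ncevalZ n k f E : nceval n (k *: f) E = k *: nceval n f E.
Proof.
rewrite /nceval (wordsum_morph (d := *:%R k)) ?scaler0 //; last first.
  by move=> u v; rewrite scalerDr.
by apply: eq_wordsum => w _; rewrite scalerA.
Qed.

Lemma ncevalB n f g E : nceval n (f - g) E = nceval n f E - nceval n g E.
Proof. by rewrite ncevalD -[- g]scaleN1r ncevalZ scaleN1r. Qed.

(** A word of length m + n splits in just one way into factors of lengths m and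
    n, so homogeneity of f leaves a single term in each convolution. *)
Lemma nceval_mul m n f g E : nchomog m f ->
  nceval (m + n) (ncmul f g) E =
  nceval m f (fun u => nceval n g (fun v => E (u ++ v))).
Proof.
elim: m f E => [|m IHm] f E fm.
  rewrite add0n /nceval /= (wordsum_morph (d := *:%R (f [::]))) ?scaler0 //.
    apply: eq_wordsum => -[|x w] _ /=; first by rewrite scalerA.
    by rewrite nchomog0_shift // ncmul0l addr0 scalerA.
  by move=> u v; rewrite scalerDr.
rewrite /nceval /=; apply: eq_bigr => x _.
rewrite -[RHS](IHm (ncshift x f) (fun w => E (x :: w)) (nchomog_shift x fm)).
apply: eq_wordsum => w _; rewrite /= [f [::]]fm // mul0r add0r.
by [].
Qed.

End Evaluation.

Section Expansion.
Variables (K : comNzRingType) (X : eqType).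
Notation L := (freeLie K X).
Implicit Types (u v : L).

Definition ncgen x : ncseries K X := fun w => (w == [:: x])%:R.
Definition expand : L -> ncseries K X := fl_lift ncgen.

Lemma expand_gen x : expand (fl_gen x) = ncgen x.
Proof. exact: fl_lift_gen. Qed.

Lemma expand_linear k u v : expand (k *: u + v) = k *: expand u + expand v.
Proof. exact: (fl_lift_morphism _).1. Qed.

Lemma expand_lie u v :
  expand [lie u, v] = ncmul (expand u) (expand v) - ncmul (expand v) (expand u).
Proof. exact: (fl_lift_morphism _).2. Qed.

Lemma expand0 : expand 0 = 0.
Proof.
have := expand_linear (-1) 0 0.
by rewrite scaler0 addr0 scaleN1r addNr.
Qed.

Lemma expandZ k u : expand (k *: u) = k *: expand u.
Proof. by have := expand_linear k u 0; rewrite expand0 !addr0. Qed.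

Lemma expandD u v : expand (u + v) = expand u + expand v.
Proof. by have := expand_linear 1 u v; rewrite !scale1r. Qed.

(** The constant term of a commutator vanishes because scalars commute. *)
Lemma expand_nil u : expand u [::] = 0.
Proof.
elim/fl_ind: u => [x|k u v IHu IHv|u v IHu IHv|].
- by rewrite expand_gen.
- by rewrite expand_linear -[LHS]/(k * expand u [::] + _) IHu IHv mulr0 addr0.
- by rewrite expand_lie -[LHS]/(_ * _ - _ * _) IHu !mul0r mulr0 subr0.
- by rewrite expand0.
Qed.

Lemma expand_homog n u : fl_homog n u -> nchomog n (expand u).
Proof.
elim=> {n u} [x|m n u v _ IHu _ IHv|n|n k u v _ IHu _ IHv] w wn.
- rewrite expand_gen /ncgen; case: eqP => // wE.
  by rewrite wE eqxx in wn.
- have wn' : size w != (n + m)%N by rewrite addnC.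
  rewrite expand_lie -[LHS]/(_ w - _ w) (nchomog_mul IHu IHv wn).
  by rewrite (nchomog_mul IHv IHu wn') subr0.
- by rewrite expand0.
- by rewrite expand_linear -[LHS]/(k * _ w + _ w) IHu // IHv // mulr0 addr0.
Qed.

Definition ad_word (w : seq X) v : L := foldr (fun x => lie (fl_gen x)) v w.

Lemma ad_wordD w u v : ad_word w (u + v) = ad_word w u + ad_word w v.
Proof. by elim: w => //= x w ->; rewrite lieDr. Qed.

Lemma ad_wordZ w k v : ad_word w (k *: v) = k *: ad_word w v.
Proof. by elim: w => //= x w ->; rewrite lieZr. Qed.

Lemma ad_word0 w : ad_word w 0 = 0.
Proof. by elim: w => //= x w ->; rewrite lie0r. Qed.

Fixpoint right_normed (w : seq X) : L :=
  match w with
  | [::] => 0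
  | [:: x] => fl_gen x
  | x :: w' => [lie fl_gen x, right_normed w']
  end.

Lemma right_normed_cat w w' :
  w' != [::] -> right_normed (w ++ w') = ad_word w (right_normed w').
Proof.
move=> w'0; elim: w => //= x w <-.
by case: w => [|y w] //=; case: w' w'0.
Qed.

Lemma right_normed_homog w : fl_homog (size w) (right_normed w).
Proof.
elim: w => [|x [|y w] IHw]; [exact: Homog0|exact: Homog_gen|].
by rewrite -[size _]/(1 + size (y :: w))%N; apply: Homog_lie IHw; apply: Homog_gen.
Qed.

End Expansion.

(** The Jacobi identity, in the form that says that ad is a morphism. *)
Lemma lie_leibniz (K : comNzRingType) (L : lieAlgType K) (u v w : L) :
  [lie [lie u, v], w] = [lie u, [lie v, w]] - [lie v, [lie u, w]].
Proof.
have := lie_jacobi u v w.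
rewrite (lieC w u) lieNr (lieC w [lie u, v]) => /eqP.
by rewrite subr_eq0 => /eqP <-.
Qed.

Section DynkinSpechtWever.
Variables (K : comNzRingType) (X : finType).
Notation L := (freeLie K X).
Implicit Types (u v : L).

(** ad is the restriction to Lie elements of the algebra morphism that sends a
    word to the composite of the ad of its letters. *)
Lemma nceval_ad_word n u v :
  fl_homog n u -> nceval n (expand u) (fun w => ad_word w v) = [lie u, v].
Proof.
move=> un; elim: un v => {n u} [x|m n u u' um IHu un IHu'|n|n k u u' _ IHu _ IHu'] v.
- rewrite expand_gen /nceval /= (bigD1 x) //= big1 /ncgen => [|y].
    by rewrite eqxx scale1r addr0.
  by rewrite eqseq_cons andbT => /negPf ->; rewrite scale0r.
- rewrite expand_lie ncevalB nceval_mul; last exact: expand_homog.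
  rewrite addnC nceval_mul; last exact: expand_homog.
  have E p q t t' (tp : fl_homog p t) (tq : fl_homog q t') :
      (forall v, nceval p (expand t) (fun w => ad_word w v) = [lie t, v]) ->
      (forall v, nceval q (expand t') (fun w => ad_word w v) = [lie t', v]) ->
      nceval p (expand t) (fun w => nceval q (expand t')
         (fun w' => ad_word (w ++ w') v)) = [lie t, [lie t', v]].
    move=> Et Et'; rewrite -Et; apply: eq_wordsum => w _; congr (_ *: _).
    rewrite -Et' (wordsum_morph (d := ad_word w)).
    + by apply: eq_wordsum => w' _; rewrite ad_wordZ /ad_word foldr_cat.
    + exact: ad_word0.
    + exact: ad_wordD.
  by rewrite (E m n) // (E n m) // lie_leibniz.
- by rewrite expand0 lie0l; apply: wordsum0 => w _; rewrite scale0r.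
- by rewrite expand_linear ncevalD ncevalZ IHu IHu' lie_linearl.
Qed.

(** With r the linear map that replaces words by right-normed brackets, the
    two products of homogeneous u and v give r(uv) = [u, r(v)] = n [u, v] and
    r(vu) = [v, r(u)] = m [v, u]; subtracting them gives (m + n) [u, v]. *)
Lemma dynkin_specht_wever n u :
  fl_homog n u -> nceval n (expand u) (@right_normed K X) = n%:R *: u.
Proof.
have E p q t t' : fl_homog p t ->
    nceval q (expand t') (@right_normed K X) = q%:R *: t' ->
    nceval p (expand t) (fun w => nceval q (expand t')
       (fun w' => right_normed K (w ++ w'))) = q%:R *: [lie t, t'].
  move=> tp Et'; rewrite -lieZr -(nceval_ad_word _ tp).
  apply: eq_wordsum => w _; congr (_ *: _).
  rewrite -Et' (wordsum_morph (d := ad_word w)).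
  + apply: eq_wordsum => w' _; rewrite ad_wordZ.
    (* The factorization of [right_normed] requires a nonempty second factor;
       the empty one has coefficient 0. *)
    have [->|w'0] := eqVneq w' [::]; first by rewrite expand_nil !scale0r.
    by rewrite right_normed_cat.
  + exact: ad_word0.
  + exact: ad_wordD.
elim=> {n u} [x|m n u u' um IHu un IHu'|n|n k u u' _ IHu _ IHu'].
- rewrite expand_gen /nceval /= (bigD1 x) //= big1 /ncgen => [|y].
    by rewrite eqxx !scale1r addr0.
  by rewrite eqseq_cons andbT => /negPf ->; rewrite scale0r.
- rewrite expand_lie ncevalB nceval_mul; last exact: expand_homog.
  rewrite (E m n) // addnC nceval_mul; last exact: expand_homog.
  by rewrite (E n m) // (lieC u' u) scalerN opprK -scalerDl -natrD.
- by rewrite expand0 scaler0; apply: wordsum0 => w _; rewrite scale0r.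
- rewrite expand_linear ncevalD ncevalZ IHu IHu' scalerDr !scalerA.
  by rewrite (mulrC k).
Qed.

End DynkinSpechtWever.

Lemma expand_inj_homog (K : numFieldType) (X : finType) n (u : freeLie K X) :
  (0 < n)%N -> fl_homog n u -> expand u =1 (fun=> 0) -> u = 0.
Proof.
move=> n0 /dynkin_specht_wever un u0; apply: (scalerI (a := n%:R)).
  by rewrite pnatr_eq0 -lt0n.
rewrite -un scaler0; apply: wordsum0 => w _.
by rewrite u0 scale0r.
Qed.

(** * Derivations *)

Lemma derivation0 (K : comNzRingType) (L : lieAlgType K) (d : L -> L) :
  derivation d -> d 0 = 0.
Proof.
by move=> [dL _]; have := dL (-1) 0 0; rewrite scaler0 addr0 scaleN1r addNr.
Qed.

Section SeriesDerivation.
Variables (K : comNzRingType) (X : finType) (d : X -> X -> K).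
Notation A := (ncseries K X).
Implicit Types (f g : A) (w : seq X).

(** The derivation that maps the letter x to the combination of the letters y
    with coefficients [d x y].  The coefficient of xv collects the words yv in
    which the first letter y becomes x, and the words that begin with x already
    and become xv by a change in a later letter. *)
Fixpoint ncder f w {struct w} : K :=
  if w is x :: v then \sum_y d y x * f (y :: v) + ncder (ncshift x f) v else 0.

Lemma ncder_linear k f g w : ncder (k *: f + g) w = k * ncder f w + ncder g w.
Proof.
elim: w f g => [|x w IHw] f g /=; first by rewrite mulr0 addr0.
rewrite -[ncshift x _]/(k *: ncshift x f + ncshift x g) IHw.
rewrite mulrDr addrACA mulr_sumr -big_split /=; congr (_ + _).
by apply: eq_bigr => y _; rewrite -[(_ + g) _]/(k * _ _ + g _) mulrDr mulrCA.
Qed.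

Lemma ncder0 w : ncder 0 w = 0.
Proof.
have := ncder_linear (-1) 0 0 w.
by rewrite scaler0 addr0 mulN1r addNr.
Qed.

Lemma ncderB f g w : ncder (f - g) w = ncder f w - ncder g w.
Proof. by rewrite addrC -scaleN1r ncder_linear mulN1r addrC. Qed.

Lemma ncderM f g w :
  ncder (ncmul f g) w = ncmul (ncder f) g w + ncmul f (ncder g) w.
Proof.
elim: w f g => [|x w IHw] f g /=; first by rewrite mul0r mulr0 addr0.
have -> : ncshift x (ncmul f g)
    = f [::] *: ncshift x g + ncmul (ncshift x f) g by [].
rewrite ncder_linear IHw mul0r add0r.
have -> : ncshift x (ncder f)
    = \sum_y d y x *: ncshift y f + ncder (ncshift x f).
  by apply/funext => v; rewrite -[RHS]/((\sum_y _) v + _) fct_sumE.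
rewrite ncmulDl ncmul_suml mulrDr.
rewrite (eq_bigr (fun y => f [::] * (d y x * g (y :: w)) +
                           ncmul (d y x *: ncshift y f) g w)).
  by rewrite big_split /= mulr_sumr; ring.
by move=> y _; rewrite ncmulZl /= mulrDr mulrCA.
Qed.

Lemma expand_der (delta : X -> freeLie K X) :
  (forall x, delta x = \sum_y d x y *: fl_gen y) ->
  forall u, expand (fl_der delta u) = ncder (expand u).
Proof.
move=> deltaE u; have [derL derB] := fl_der_derivation delta.
apply/funext => w; move: w; elim/fl_ind: u => [x|k u v IHu IHv|u v IHu IHv|] w.
- have -> : expand (fl_der delta (fl_gen x)) = \sum_y d x y *: ncgen K y.
    rewrite fl_der_gen deltaE (big_morph _ (@expandD K X) (expand0 K X)).
    by apply: eq_bigr => y _; rewrite expandZ expand_gen.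
  rewrite expand_gen fct_sumE; case: w => [|z w] /=.
    by rewrite big1 // => y _; rewrite -[LHS]/(_ * _) mulr0.
  have -> : ncder (ncshift z (ncgen K x)) w = 0.
    case: w => [|y w] //=; rewrite big1 => [|y' _].
      rewrite (_ : ncshift _ _ = 0) ?ncder0 ?addr0 //.
      by apply/funext => v; rewrite /ncshift /ncgen eqseq_cons andbF.
    by rewrite /ncshift /ncgen eqseq_cons andbF mulr0.
  rewrite addr0 (bigD1 z) //= big1 => [|y /negPf yz]; last first.
    by rewrite -[LHS]/(d x y * _) /ncgen eqseq_cons eq_sym yz mulr0.
  rewrite (bigD1 x) //= [X in _ = _ + X]big1 => [|y /negPf yx]; last first.
    by rewrite /ncgen eqseq_cons yx mulr0.
  by rewrite -[LHS]/(d x z * _ + _) /ncgen !eqseq_cons !eqxx.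
- by rewrite derL !expand_linear ncder_linear -IHu -IHv.
- rewrite derB expandD !expand_lie.
  rewrite -[LHS]/(_ w - _ w + (_ w - _ w)) (funext IHu) (funext IHv).
  by rewrite ncderB !ncderM; ring.
- by rewrite derivation0 ?expand0 ?ncder0 //; apply: fl_der_derivation.
Qed.

End SeriesDerivation.

Lemma fl_homogD (K : comNzRingType) (X : Type) n (u v : freeLie K X) :
  fl_homog n u -> fl_homog n v -> fl_homog n (u + v).
Proof. by rewrite -{2}[u]scale1r; apply: Homog_lin. Qed.

Lemma fl_homogZ (K : comNzRingType) (X : Type) n k (u : freeLie K X) :
  fl_homog n u -> fl_homog n (k *: u).
Proof. by move=> un; rewrite -[k *: u]addr0; apply: Homog_lin (Homog0 _ _ _). Qed.

Lemma fl_homogB (K : comNzRingType) (X : Type) n (u v : freeLie K X) :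
  fl_homog n u -> fl_homog n v -> fl_homog n (u - v).
Proof. by move=> un vn; rewrite addrC -scaleN1r; apply: Homog_lin. Qed.

Lemma fl_homog_der (K : comNzRingType) (X : Type) (delta : X -> freeLie K X) n u :
  (forall x, fl_homog 1 (delta x)) -> fl_homog n u -> fl_homog n (fl_der delta u).
Proof.
move=> delta1; have [derL derB] := fl_der_derivation delta.
elim=> {n u} [x|m n u v um IHu vn IHv|n|n k u v _ IHu _ IHv].
- by rewrite fl_der_gen.
- by rewrite derB; apply: fl_homogD; apply: Homog_lie.
- by rewrite derivation0; [apply: Homog0|apply: fl_der_derivation].
- by rewrite derL; apply: Homog_lin.
Qed.

(** * Exact computation with integral noncommutative polynomials *)

Definition letter_code (i : letter) : option bool :=
  match i with La => Some true | Lb => None | Lc => Some false end.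
Definition letter_decode (o : option bool) : letter :=
  match o with Some true => La | None => Lb | Some false => Lc end.
Fact letter_codeK : cancel letter_code letter_decode. Proof. by case. Qed.
HB.instance Definition _ := Countable.copy letter (can_type letter_codeK).
Fact letter_enumP : Finite.axiom [:: La; Lb; Lc]. Proof. by case. Qed.
HB.instance Definition _ := isFinite.Build letter letter_enumP.

Lemma big_letter (V : nmodType) (F : letter -> V) :
  \sum_i F i = F La + (F Lb + F Lc).
Proof. by rewrite /index_enum !unlock /= addr0. Qed.

Definition zcast (K : comNzRingType) (z : Z) : K := (int_of_Z z)%:~R.

Section Zcast.
Variable K : comNzRingType.
Notation zcast := (zcast K).

Lemma zcastD a b : zcast (Z.add a b) = zcast a + zcast b.
Proof. by rewrite /zcast -[(Z.add a b)]/(a + b)%R rmorphD intrD. Qed.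
Lemma zcastM a b : zcast (Z.mul a b) = zcast a * zcast b.
Proof. by rewrite /zcast -[(Z.mul a b)]/(a * b)%R rmorphM intrM. Qed.
Lemma zcastN a : zcast (Z.opp a) = - zcast a.
Proof. by rewrite /zcast -[(Z.opp a)]/(- a)%R rmorphN intrN. Qed.
Lemma zcast_nat n : zcast (Z.of_nat n) = n%:R.
Proof.
elim: n => [//|n IHn]; rewrite Nat2Z.inj_succ -Z.add_1_l zcastD IHn.
by rewrite -[n.+1]add1n natrD.
Qed.

End Zcast.

Lemma zcast_eq0 (K : numDomainType) z : (zcast K z == 0) = (z == Z0).
Proof. by rewrite intr_eq0 -(inj_eq (can_inj int_of_ZK)). Qed.

(** Noncommutative polynomials in a, b, c with integer coefficients, as trees
    branching on the first letter: the constant term, then the three quotients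
    on the left by a, b and c. *)
Inductive trie := TEmpty | TNode of Z & trie & trie & trie.

Fixpoint tcoef t (w : seq letter) {struct t} : Z :=
  match t, w with
  | TEmpty, _ => Z0
  | TNode c _ _ _, [::] => c
  | TNode _ ta _ _, La :: v => tcoef ta v
  | TNode _ _ tb _, Lb :: v => tcoef tb v
  | TNode _ _ _ tc, Lc :: v => tcoef tc v
  end.

(** Pruning null subtrees keeps the tries sparse when terms cancel. *)
Definition tnode c ta tb tc :=
  match c, ta, tb, tc with
  | Z0, TEmpty, TEmpty, TEmpty => TEmpty
  | _, _, _, _ => TNode c ta tb tc
  end.
Arguments tnode : simpl never.

Fixpoint tadd s t :=
  match s, t with
  | TEmpty, _ => t
  | _, TEmpty => s
  | TNode c sa sb sc, TNode d ta tb tc =>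
      tnode (c + d) (tadd sa ta) (tadd sb tb) (tadd sc tc)
  end.

Fixpoint tscale_rec k t :=
  if t is TNode c ta tb tc then
    TNode (k * c) (tscale_rec k ta) (tscale_rec k tb) (tscale_rec k tc)
  else TEmpty.

Definition tscale k t := if Z.eqb k 0 then TEmpty else tscale_rec k t.

Definition tsub s t := tadd s (tscale (-1) t).

Fixpoint tmul s t :=
  if s is TNode c sa sb sc then
    tadd (tscale c t) (TNode 0 (tmul sa t) (tmul sb t) (tmul sc t))
  else TEmpty.

Definition tbracket s t := tsub (tmul s t) (tmul t s).

Definition tgen i :=
  let one := TNode 1 TEmpty TEmpty TEmpty in
  match i with
  | La => TNode 0 one TEmpty TEmpty
  | Lb => TNode 0 TEmpty one TEmpty
  | Lc => TNode 0 TEmpty TEmpty one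
  end.

Fixpoint tder (d : letter -> letter -> Z) t :=
  if t is TNode _ ta tb tc then
    let subst i := tadd (tscale (d La i) ta)
                        (tadd (tscale (d Lb i) tb) (tscale (d Lc i) tc)) in
    tnode 0 (tadd (subst La) (tder d ta)) (tadd (subst Lb) (tder d tb))
            (tadd (subst Lc) (tder d tc))
  else TEmpty.

Fixpoint tnull t :=
  if t is TNode c ta tb tc then [&& Z.eqb c 0, tnull ta, tnull tb & tnull tc]
  else true.

Fixpoint tright_normed (w : seq letter) :=
  match w with
  | [::] => TEmpty
  | [:: x] => tgen x
  | x :: w' => tbracket (tgen x) (tright_normed w')
  end.

Section TrieSoundness.
Variable K : comNzRingType.
Notation L := (freeLie K letter).
Implicit Types (u v : L) (s t : trie).

Definition tseries t : ncseries K letter := fun w => zcast K (tcoef t w).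

Lemma tseries0 : tseries TEmpty = 0. Proof. by []. Qed.

Lemma tseries_node c ta tb tc :
  tseries (tnode c ta tb tc) = tseries (TNode c ta tb tc).
Proof.
apply/funext => w; rewrite /tseries; congr zcast.
by case: c ta tb tc => [|?|?] [|????] [|????] [|????] //=; case: w => [|[] w].
Qed.

Lemma tseriesD s t w : tseries (tadd s t) w = tseries s w + tseries t w.
Proof.
elim: s t w => [|c sa IHa sb IHb sc IHc] t w /=.
  by rewrite tseries0 add0r.
case: t => [|d ta tb tc] /=; first by rewrite tseries0 addr0.
rewrite tseries_node; case: w => [|[] w].
- exact: zcastD.
- exact: IHa.
- exact: IHb.
- exact: IHc.
Qed.

Lemma tseriesZ k t w : tseries (tscale k t) w = zcast K k * tseries t w.
Proof.
rewrite /tseries -zcastM; congr zcast; rewrite /tscale.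
case: Z.eqb_spec => [->//|_].
elim: t w => [|c ta IHa tb IHb tc IHc] w /=; first by rewrite Z.mul_0_r.
by case: w => [|[] w].
Qed.

Lemma tseriesB s t w : tseries (tsub s t) w = tseries s w - tseries t w.
Proof. by rewrite tseriesD tseriesZ mulN1r. Qed.

Lemma tseriesM s t w : tseries (tmul s t) w = ncmul (tseries s) (tseries t) w.
Proof.
elim: s t w => [|c sa IHa sb IHb sc IHc] t w /=; first by rewrite tseries0 ncmul0l.
rewrite tseriesD tseriesZ.
case: w => [|[] w] /=; first by rewrite addr0.
- by congr (_ + _); apply: IHa.
- by congr (_ + _); apply: IHb.
- by congr (_ + _); apply: IHc.
Qed.

Lemma tseries_der d t w :
  tseries (tder d t) w = ncder (fun i j => zcast K (d i j)) (tseries t) w.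
Proof.
elim: t w => [|c ta IHa tb IHb tc IHc] w /=; first by rewrite tseries0 ncder0.
rewrite tseries_node; case: w => [|x w] //=; rewrite big_letter.
case: x; rewrite -[LHS]/(tseries (tadd _ _) w) tseriesD !tseriesD !tseriesZ.
- by congr (_ + _); apply: IHa.
- by congr (_ + _); apply: IHb.
- by congr (_ + _); apply: IHc.
Qed.

Lemma tnull_series t : tnull t -> tseries t = 0.
Proof.
move=> t0; apply/funext => w; rewrite -[RHS]/(zcast K 0); congr zcast.
elim: t t0 w => [|c ta IHa tb IHb tc IHc] //=.
case/and4P => /Z.eqb_eq c0 a0 b0 c0' [|[] w] //=; [exact: IHa|exact: IHb|exact: IHc].
Qed.

Lemma expand_tgen x : expand (fl_gen x) = tseries (tgen x).
Proof.
rewrite expand_gen; apply/funext => w.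
by case: x; case: w => [|[] [|[] w]].
Qed.

Lemma expand_tadd u v s t : expand u = tseries s -> expand v = tseries t ->
  expand (u + v) = tseries (tadd s t).
Proof.
by move=> us vt; rewrite expandD us vt; apply/funext => w; rewrite tseriesD.
Qed.

Lemma expand_tsub u v s t : expand u = tseries s -> expand v = tseries t ->
  expand (u - v) = tseries (tsub s t).
Proof.
move=> us vt; rewrite expandD -scaleN1r expandZ scaleN1r us vt.
by apply/funext => w; rewrite tseriesB.
Qed.

Lemma expand_tscale n u t : expand u = tseries t ->
  expand (n%:R *: u) = tseries (tscale (Z.of_nat n) t).
Proof.
move=> ut; rewrite expandZ ut; apply/funext => w.
by rewrite tseriesZ zcast_nat.
Qed.

Lemma expand_tbracket u v s t : expand u = tseries s -> expand v = tseries t ->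
  expand [lie u, v] = tseries (tbracket s t).
Proof.
move=> us vt; rewrite expand_lie us vt; apply/funext => w.
by rewrite tseriesB !tseriesM.
Qed.

Lemma expand_tright_normed w :
  expand (right_normed K w) = tseries (tright_normed w).
Proof.
elim: w => [|x [|y w] IHw]; [exact: expand0|exact: expand_tgen|].
by apply: expand_tbracket IHw; apply: expand_tgen.
Qed.

End TrieSoundness.

(** * The certificate *)

Fixpoint all_words n (P : seq letter -> bool) :=
  if n is m.+1 then
    [&& all_words m (fun w => P (La :: w)), all_words m (fun w => P (Lb :: w))
      & all_words m (fun w => P (Lc :: w))]
  else P [::].

Lemma all_wordsP n P w : all_words n P -> size w = n -> P w.
Proof.
elim: n P w => [|n IHn] P [|x w] //= /and3P[Pa Pb Pc] [wn].
by case: x; [apply: (IHn (fun v => P (La :: v)))|apply: (IHn (fun v => P (Lb :: v)))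
            |apply: (IHn (fun v => P (Lc :: v)))].
Qed.

(** The matrices of x, y and h on the letters: the coefficient of j in the
    action on i. *)
Definition coef_x (i j : letter) : Z :=
  match i, j with Lb, La => -2 | Lc, Lb => 1 | _, _ => 0 end.
Definition coef_y (i j : letter) : Z :=
  match i, j with La, Lb => -1 | Lb, Lc => 2 | _, _ => 0 end.
Definition letter_weight (i : letter) : Z :=
  match i with La => 2 | Lb => 0 | Lc => -2 end.
Definition coef_h (i j : letter) : Z := if i == j then letter_weight i else Z0.

Fixpoint weight (w : seq letter) : Z :=
  if w is x :: v then Z.add (letter_weight x) (weight v) else Z0.

Definition tcasimir_shift m t :=
  tsub (tder coef_y (tder coef_x t)) (tscale (Z.of_nat (m * m.+1)) t).

Definition tfilter t := foldr tcasimir_shift t (iota 1 5).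

(** A word of weight 0 with nonzero coefficient, equal to 4, in the expansion
    of I6; comparing coefficients there gives the candidate factor of
    proportionality. *)
Definition pivot := [:: La; La; Lb; Lc; Lb; Lc].

Definition proportional s t :=
  tnull (tsub (tscale (tcoef s pivot) t) (tscale (tcoef t pivot) s)).

Definition certificate s :=
  [&& tnull (tder coef_x s), tnull (tder coef_y s),
      tcoef s pivot != Z0 &
      all_words 6 (fun w =>
        Z.eqb (weight w) 0 ==> proportional s (tfilter (tright_normed w)))].

(** The expansion of I6 is left as an existential variable and is built by the
    lemmas that compute each operation on tries; the certificate is then
    evaluated once for all coefficient rings, since it concerns integers. *)
Lemma I6_certificate K : exists2 s, expand (I6 K) = tseries K s & certificate s.
Proof.
eexists.
  rewrite /I6.
  repeat first [apply: expand_tgen | apply: expand_tbracket | apply: expand_tscale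
    | apply: expand_tsub | apply: expand_tadd].
by vm_compute.
Qed.

(** * The action of sl2 on expansions *)

Section Equivariance.
Variable K : comNzRingType.
Notation L := (freeLie K letter).
Implicit Types (u v : L) (t : trie).

Definition acts_by (D : sl2 K) (coef : letter -> letter -> Z) :=
  forall i, sl2_act D (fl_gen i) = \sum_j zcast K (coef i j) *: fl_gen j.

Lemma acts_by_x : acts_by sl2_x coef_x.
Proof.
have [[xa xb xc] _ _] := sl2_act_table K.
case; rewrite big_letter ?(xa, xb, xc) /= ?scale0r ?scale1r ?add0r ?addr0 //.
by rewrite (zcastN K 2) scaleNr.
Qed.

Lemma acts_by_y : acts_by sl2_y coef_y.
Proof.
have [_ _ [ya yb yc]] := sl2_act_table K.
case; rewrite big_letter ?(ya, yb, yc) /= ?scale0r ?scale1r ?add0r ?addr0 //.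
by rewrite (zcastN K 1) scaleN1r.
Qed.

Lemma acts_by_h : acts_by sl2_h coef_h.
Proof.
have [_ [ha hb hc] _] := sl2_act_table K.
case; rewrite big_letter ?(ha, hb, hc) /= ?scale0r ?scale1r ?add0r ?addr0 //.
by rewrite (zcastN K 2) scaleNr.
Qed.

Lemma expand_act D coef u : acts_by D coef ->
  expand (sl2_act D u) = ncder (fun i j => zcast K (coef i j)) (expand u).
Proof. by move=> DE; apply: expand_der => i; rewrite -DE sl2_act_gen. Qed.

Lemma expand_tder D coef u t : acts_by D coef -> expand u = tseries K t ->
  expand (sl2_act D u) = tseries K (tder coef t).
Proof.
move=> DE ut; rewrite (expand_act u DE) ut; apply/funext => w.
by rewrite tseries_der.
Qed.

Lemma expand_h u w :
  expand (sl2_act sl2_h u) w = zcast K (weight w) * expand u w.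
Proof.
rewrite (expand_act u acts_by_h); move: (expand u) => f.
elim: w f => [|x w IHw] f /=; first by rewrite mul0r.
rewrite IHw zcastD mulrDl; congr (_ + _).
rewrite (bigD1 x) //= big1 => [|y /negPf yx].
  by rewrite addr0 /coef_h eqxx.
by rewrite /coef_h yx mul0r.
Qed.

Lemma sl2_act_homog D n u : fl_homog n u -> fl_homog n (sl2_act D u).
Proof.
apply: fl_homog_der => i; rewrite /sl2_to_L1.
by do 2?apply: fl_homogD; apply: fl_homogZ; apply: Homog_gen.
Qed.

(** x and y generate sl2. *)
Lemma sl2_invariantP u :
  sl2_act sl2_x u = 0 -> sl2_act sl2_y u = 0 -> forall D, sl2_act D u = 0.
Proof.
move=> xu yu D.
have hu : sl2_act sl2_h u = 0.
  by rewrite -sl2_lie_xy sl2_act_lie xu yu !sl2_act0 subrr.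
have act0 : sl2_act 0 u = 0.
  have := sl2_act_linearl (-1) 0 0 u.
  by rewrite scaler0 addr0 scaleN1r addNr.
rewrite (sl2_coord D) addrC sl2_act_linearl yu sl2_act_linearl xu.
by rewrite -[_ *: sl2_h]addr0 sl2_act_linearl hu act0 !scaler0 !addr0.
Qed.

Definition casimir_shift m u : L :=
  sl2_act sl2_y (sl2_act sl2_x u) - (m * m.+1)%:R *: u.

(** This kills the weight 0 vectors of the irreducible components of highest
    weights 2, 4, 6, 8 and 10. *)
Definition invariant_filter u := foldr casimir_shift u (iota 1 5).

Lemma casimir_shiftD m u v :
  casimir_shift m (u + v) = casimir_shift m u + casimir_shift m v.
Proof. by rewrite /casimir_shift !sl2_actD scalerDr opprD addrACA. Qed.

Lemma casimir_shiftZ m k u : casimir_shift m (k *: u) = k *: casimir_shift m u.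
Proof. by rewrite /casimir_shift !sl2_actZ scalerBr !scalerA mulrC. Qed.

Lemma invariant_filterD u v :
  invariant_filter (u + v) = invariant_filter u + invariant_filter v.
Proof.
by rewrite /invariant_filter; elim: iota => //= m ms ->; rewrite casimir_shiftD.
Qed.

Lemma invariant_filterZ k u :
  invariant_filter (k *: u) = k *: invariant_filter u.
Proof.
by rewrite /invariant_filter; elim: iota => //= m ms ->; rewrite casimir_shiftZ.
Qed.

Lemma invariant_filter_homog n u :
  fl_homog n u -> fl_homog n (invariant_filter u).
Proof.
rewrite /invariant_filter => un; elim: iota => //= m ms IHms.
by apply: fl_homogB; [do 2!apply: sl2_act_homog|apply: fl_homogZ].
Qed.

Lemma invariant_filter_id u : sl2_act sl2_x u = 0 ->
  invariant_filter u = (- (5`! * 6`!)%:R) *: u.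
Proof.
move=> xu.
have E m k : casimir_shift m (k *: u) = (- (m * m.+1)%:R * k) *: u.
  rewrite casimir_shiftZ /casimir_shift xu sl2_act0 sub0r scalerN scalerA.
  by rewrite -scaleNr mulrC mulNr.
rewrite /invariant_filter /= -[X in casimir_shift 5 X]scale1r !E; congr (_ *: _).
by rewrite !mulNr !mulrN !opprK !mulr1 -!natrM.
Qed.

Lemma expand_tfilter u t : expand u = tseries K t ->
  expand (invariant_filter u) = tseries K (tfilter t).
Proof.
rewrite /invariant_filter /tfilter => ut; elim: iota => //= m ms IHms.
apply: expand_tsub; last exact: expand_tscale.
apply: expand_tder acts_by_y _; exact: expand_tder acts_by_x _.
Qed.

End Equivariance.

(** * Uniqueness in degree six *)

Section DegreeSix.
Variable K : numFieldType.
Notation L := (freeLie K letter).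
Implicit Types (u v : L).

Lemma I6_homog : fl_homog 6 (I6 K).
Proof.
have homog_lie m n p u v :
    fl_homog m u -> fl_homog n v -> (m + n)%N = p -> fl_homog p [lie u, v].
  by move=> um vn <-; apply: Homog_lie.
(* The degrees of the subterms are left to unification: they are determined
   from the generators upwards, and the sum is compared with 6 last. *)
rewrite /I6.
repeat first [apply: fl_homogB | apply: fl_homogD | apply: fl_homogZ
  | eapply homog_lie | apply: Homog_gen | reflexivity].
Qed.

Lemma I6_invariant : lie_invariant K 6 (I6 K).
Proof.
split=> [|D]; first exact: I6_homog.
have [s Is /and4P[xs ys _ _]] := I6_certificate K.
have null d coef : acts_by d coef -> tnull (tder coef s) -> sl2_act d (I6 K) = 0.
  move=> dE s0; apply: (@expand_inj_homog _ _ 6) => //.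
    exact: sl2_act_homog I6_homog.
  by move=> w; rewrite (expand_tder dE Is) tnull_series.
apply: sl2_invariantP.
  exact: null (@acts_by_x K) xs.
exact: null (@acts_by_y K) ys.
Qed.

Lemma I6_neq0 : I6 K != 0.
Proof.
have [s Is /and4P[_ _ s0 _]] := I6_certificate K.
apply: contraNneq s0 => I0; rewrite -(zcast_eq0 K).
by rewrite -[zcast K _]/(tseries K s pivot) -Is I0 expand0.
Qed.

Definition on_I6_line u := exists k, u = k *: I6 K.

(** The proportionality of the integral expansions, which the certificate
    checks, lifts to the free Lie algebra because [expand] is injective in
    degree 6. *)
Lemma filter_right_normed w : size w = 6%N -> weight w = Z0 ->
  on_I6_line (invariant_filter (right_normed K w)).
Proof.
move=> w6 w0; have [s Is /and4P[_ _ s0 /all_wordsP/(_ w6)]] := I6_certificate K.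
rewrite w0 /= /proportional; set t := tfilter _ => st.
have wt : expand (invariant_filter (right_normed K w)) = tseries K t.
  by apply: expand_tfilter; apply: expand_tright_normed.
have s0K : zcast K (tcoef s pivot) != 0 by rewrite zcast_eq0.
exists ((zcast K (tcoef s pivot))^-1 * zcast K (tcoef t pivot)).
apply: (scalerI s0K); rewrite [RHS]scalerA mulrA divff // mul1r.
apply/eqP; rewrite -subr_eq0; apply/eqP.
apply: (@expand_inj_homog _ _ 6) => // [|v].
  apply: fl_homogB; apply: fl_homogZ; last exact: I6_homog.
  by apply: invariant_filter_homog; rewrite -w6; apply: right_normed_homog.
rewrite expandD -scaleN1r !expandZ wt Is scaleN1r.
have := congr1 (fun f => f v) (tnull_series K st).
by rewrite tseriesB !tseriesZ.
Qed.

(** The operator [invariant_filter] acts on Z as a nonzero scalar, but sends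
    every bracket of weight 0 in the expansion of 6 Z into the line of I6. *)
Lemma lie_invariant6 Z : lie_invariant K 6 Z -> on_I6_line Z.
Proof.
move=> [Z6 DZ].
have wtZ w : weight w != Z0 -> expand Z w = 0.
  rewrite -(zcast_eq0 K) => w0; apply: (mulfI w0).
  by rewrite -expand_h DZ expand0 mulr0.
have line_sum : on_I6_line (invariant_filter (6%:R *: Z)).
  rewrite -(dynkin_specht_wever Z6) (wordsum_morph (d := @invariant_filter K)).
  - apply: wordsum_closed.
    + by exists 0; rewrite scale0r.
    + by move=> _ _ [k ->] [l ->]; exists (k + l); rewrite scalerDl.
    move=> w w6; rewrite invariant_filterZ.
    have [/(filter_right_normed w6) [k ->]|/wtZ ->] := eqVneq (weight w) Z0.
      by exists (expand Z w * k); rewrite scalerA.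
    by exists 0; rewrite !scale0r.
  - by have := @invariant_filterZ K 0 0; rewrite !scale0r.
  - exact: invariant_filterD.
move: line_sum => [k]; rewrite invariant_filterZ invariant_filter_id ?DZ //.
rewrite scalerA; set q := (_ * _) => qZ.
have q0 : q != 0.
  by rewrite mulf_neq0 ?oppr_eq0 ?pnatr_eq0 // muln_eq0 -!lt0n !fact_gt0.
by exists (q^-1 * k); rewrite -scalerA -qZ scalerA mulVf ?scale1r.
Qed.

Lemma lie_invariant6_basis :
  is_basis (lie_invariant K 6) (fun _ : 'I_1 => I6 K).
Proof.
split=> [k|].
  rewrite big_ord1 => /eqP; rewrite scaler_eq0 (negPf I6_neq0) orbF => /eqP k0 i.
  by rewrite ord1.
apply/seteqP; split=> [Z /lie_invariant6 [k ->]|Z [k ->]] /=.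
  by exists (fun=> k); rewrite big_ord1.
have [I6h I6D] := I6_invariant; rewrite big_ord1; split; first exact: fl_homogZ.
by move=> D; rewrite sl2_actZ I6D scaler0.
Qed.

End DegreeSix.

Theorem theorem17 (R : realType) :
  has_dim (lie_invariant R[i] 6) 1 /\
  is_basis (lie_invariant R[i] 6) (fun _ : 'I_1 => I6 R[i]).
Proof.
have I6_basis := lie_invariant6_basis R[i].
by split=> //; exists (fun=> I6 R[i]).
Qed.
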